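(* There is a computable complete lattice $L$ such that the set of compact elements of $L$ is $\Pi^1_1$-hard. Moreover, $L$ is not algebraic.
   Context: A computable lattice $(L,\preceq)$ has underlying set $L=\omega$ and a computable lattice ordering $\preceq$, formally a computable subset of $\omega^2$. A lattice is complete if every subset has both a supremum and an infimum. An element $a\in L$ is compact if for each subset $S\subseteq L$, if $a\preceq\sup S$ then there is a finite subset $S'\subseteq S$ such that $a\preceq\sup S'$. A lattice is compactly generated if every element is the supremum of a set of compact elements, and algebraic if it is complete and compactly generated. A set $C\subseteq\omega$ is $\Pi^1_1$ if it has the form $\{n\in\omega\mid \forall f\in\omega^\omega\ \varphi_e^f(n)\downarrow\}$ for some $e$. A set $A\subseteq\omega$ is $\Pi^1_1$-hard if for each $\Pi^1_1$ set $C$ there is a computable function $f$ such that for all $n$, $n\in C$ iff $f(n)\in A$. *)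

(* Defs.v *)
From Stdlib Require Import Cantor.
From mathcomp Require Import all_boot.
From mathcomp Require Import classical_sets cardinality.

Set Implicit Arguments.
Unset Strict Implicit.
Unset Printing Implicit Defensive.

Local Open Scope classical_set_scope.

(** * Oracle computability

   Kleene's mu-recursive functionals, in the presentation where all functions
   are unary and tuples of arguments are coded by Cantor's bijective pairing
   (the identity function is [cpair cfst csnd]). A code plays the role of the
   index [e] of the Turing functional [phi_e]. *)

Definition npair (x y : nat) : nat := Cantor.to_nat (x, y).
Definition nfst (n : nat) : nat := (Cantor.of_nat n).1.
Definition nsnd (n : nat) : nat := (Cantor.of_nat n).2.

Inductive code : Type :=
| czero
| csucc
| cfst
| csnd
| coracle
| cpair of code & code
| ccomp of code & code
| cprec of code & code
| cmu of code.

(* [base] and [step] are the graphs of the two functions of a primitive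
   recursion; [step i y z] means that the value [y] at [i] yields the value [z]
   at [i.+1]. *)
Fixpoint prec_graph (base : nat -> Prop) (step : nat -> nat -> nat -> Prop)
    (k z : nat) : Prop :=
  if k is i.+1 then exists2 y, prec_graph base step i y & step i y z
  else base z.

(* [eval f e n m] : the computation of [phi_e] with oracle [f] on input [n]
   halts with output [m]. *)
Fixpoint eval (f : nat -> nat) (e : code) (n m : nat) : Prop :=
  match e with
  | czero => m = 0
  | csucc => m = n.+1
  | cfst => m = nfst n
  | csnd => m = nsnd n
  | coracle => m = f n
  | cpair a b => exists x y, [/\ eval f a n x, eval f b n y & m = npair x y]
  | ccomp a b => exists2 x, eval f b n x & eval f a x m
  | cprec a b =>
      prec_graph (eval f a (nfst n))
        (fun i y z => eval f b (npair (nfst n) (npair i y)) z) (nsnd n) m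
  | cmu a =>
      eval f a (npair n m) 0 /\
      forall i, i < m -> exists y, eval f a (npair n i) y.+1
  end.

Definition halts (f : nat -> nat) (e : code) (n : nat) : Prop :=
  exists m, eval f e n m.

(* Absence of an oracle is rendered by the constant zero oracle. *)
Definition computable_fun (g : nat -> nat) : Prop :=
  exists e, forall n, eval (fun=> 0) e n (g n).

(* The characteristic function of the relation is computable. *)
Definition computable_rel (r : rel nat) : Prop :=
  computable_fun (fun n => r (nfst n) (nsnd n) : nat).

Definition Pi11 (C : set nat) : Prop :=
  exists e, C = [set n | forall f : nat -> nat, halts f e n].

Definition Pi11_hard (A : set nat) : Prop :=
  forall C, Pi11 C ->
  exists2 g, computable_fun g & forall n, C n <-> A (g n).

(** * Lattices with underlying set [nat] *)

Definition is_sup (le : rel nat) (S : set nat) (s : nat) : Prop :=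
  (forall x, S x -> le x s) /\
  (forall u, (forall x, S x -> le x u) -> le s u).

Definition is_inf (le : rel nat) (S : set nat) (s : nat) : Prop :=
  (forall x, S x -> le s x) /\
  (forall u, (forall x, S x -> le u x) -> le u s).

Definition lattice_ordering (le : rel nat) : Prop :=
  [/\ reflexive le, antisymmetric le, transitive le
    & forall x y, (exists s, is_sup le [set x; y] s) /\
                  (exists i, is_inf le [set x; y] i)].

Definition computable_lattice (le : rel nat) : Prop :=
  lattice_ordering le /\ computable_rel le.

Definition complete_lattice (le : rel nat) : Prop :=
  forall S : set nat, (exists s, is_sup le S s) /\ (exists i, is_inf le S i).

Definition compact_elements (le : rel nat) : set nat :=
  [set a | forall (S : set nat) s, is_sup le S s -> le a s ->
     exists S', [/\ S' `<=` S, finite_set S'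
                  & exists2 s', is_sup le S' s' & le a s']].

Definition compactly_generated (le : rel nat) : Prop :=
  forall x, exists2 S, S `<=` compact_elements le & is_sup le S x.

Definition algebraic_lattice (le : rel nat) : Prop :=
  complete_lattice le /\ compactly_generated le.

(* Main.v *)
Require Import Defs.
From Stdlib Require Cantor.
From mathcomp Require Import all_boot.
From mathcomp Require Import boolp classical_sets cardinality.

Set Implicit Arguments.
Unset Strict Implicit.
Unset Printing Implicit Defensive.

Local Open Scope classical_set_scope.

(** A set is Pi11 when membership of [n] says that a certain computable tree of
   finite sequences, the tree of oracle prefixes along which a computation on
   [n] has not yet halted, has no infinite path. So it suffices to find one
   computable complete lattice with an element [Cap i] for each index
   [i = (e, n)] that is compact exactly when the tree [T i] of [i] has no
   infinite path.

   Order a tree by extension and add a cap on top. Two incomparable nodes have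
   the cap as their only upper bound, so the only way for a set of nodes to have
   the cap as supremum without a finite subset doing so is to be cofinal in an
   infinite path: an infinite chain of nodes has no upper bound except the cap.
   Hence the cap is compact iff the tree is well-founded ([cap_compact],
   [path_not_compact]). The lattice is the horizontal sum of all these capped
   trees between a common bottom and a common top. Elements of two different
   summands have supremum top, which is reached by a two-element set, so the
   summands do not interact. Every natural number has to denote an element:
   the codes of sequences outside their tree become pairwise incomparable
   elements strictly between bottom and top.

   Completeness comes for free from well-foundedness: two elements have a
   meet, which for nodes is the longest common prefix, and there is no infinite
   descending chain, so the infimum of a nonempty set is already a finite meet
   ([wf_meet_complete]).

   Decidability of the order rests on the tree being computable uniformly in
   [(e, n)], which calls for a universal interpreter. The codes are translated
   into programs of a small stack machine whose one-step function is
   computable. The translation may be any function at all, because a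
   many-one reduction fixes [e] and computes with [n] only. The machine
   is run against the finite oracle coded by a sequence [s], for [s] steps; a
   query beyond the end of the sequence blocks it ([survives]).

   The lattice is not algebraic because the tree of a computation that never
   halts is the full tree: there a node of depth one lies below the cap of a path
   that avoids it, hence is not compact, while all the elements strictly below
   it are at most the root ([full_not_generated]). *)

(** * Pairing and closure properties of computable functions *)

Lemma nfst_pair x y : nfst (npair x y) = x.
Proof. by rewrite /nfst /npair Cantor.cancel_of_to. Qed.

Lemma nsnd_pair x y : nsnd (npair x y) = y.
Proof. by rewrite /nsnd /npair Cantor.cancel_of_to. Qed.

Lemma npair_eta n : npair (nfst n) (nsnd n) = n.
Proof. by rewrite /npair /nfst /nsnd -surjective_pairing Cantor.cancel_to_of. Qed.

Lemma leq_npair x y : x <= npair x y.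
Proof.
have /leP := Cantor.to_nat_non_decreasing x y.
by rewrite plusE /npair; apply: leq_trans; rewrite leq_addl.
Qed.

Definition npairE := (nfst_pair, nsnd_pair).

(* Keeps conversion from unfolding Cantor's polynomial on symbolic arguments. *)
#[local] Opaque npair nfst nsnd.

Lemma npair_eq i s j t : (npair i s == npair j t) = (i == j) && (s == t).
Proof.
apply/eqP/andP => [e|[/eqP-> /eqP->] //].
by split; apply/eqP; [rewrite -(nfst_pair i s) | rewrite -(nsnd_pair i s)]; rewrite e npairE.
Qed.

Section Closure.

Implicit Types F G : nat -> nat.

Lemma computable_ext F G : F =1 G -> computable_fun F -> computable_fun G.
Proof. by move=> FG [e eF]; exists e => n; rewrite -FG. Qed.

Lemma computable_id : computable_fun (fun n => n).
Proof.
by exists (cpair cfst csnd) => n /=; exists (nfst n), (nsnd n); rewrite npair_eta.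
Qed.

Lemma computable_comp F G :
  computable_fun F -> computable_fun G -> computable_fun (fun n => F (G n)).
Proof. by move=> [a aF] [b bG]; exists (ccomp a b) => n /=; exists (G n). Qed.

Lemma computable_succ F : computable_fun F -> computable_fun (fun n => (F n).+1).
Proof. by apply: (@computable_comp succn); exists csucc. Qed.

Lemma computable_const c : computable_fun (fun=> c).
Proof. by elim: c => [|c IHc]; [exists czero | apply: computable_succ]. Qed.

Lemma computable_nfst F : computable_fun F -> computable_fun (fun n => nfst (F n)).
Proof. by apply: computable_comp; exists cfst. Qed.

Lemma computable_nsnd F : computable_fun F -> computable_fun (fun n => nsnd (F n)).
Proof. by apply: computable_comp; exists csnd. Qed.

Lemma computable_npair F G :
  computable_fun F -> computable_fun G -> computable_fun (fun n => npair (F n) (G n)).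
Proof.
by move=> [a aF] [b bG]; exists (cpair a b) => n /=; exists (F n), (G n).
Qed.

Definition computable2 (G : nat -> nat -> nat) : Prop :=
  computable_fun (fun m => G (nfst m) (nsnd m)).

Lemma computable_comp2 (G : nat -> nat -> nat) F1 F2 :
  computable2 G -> computable_fun F1 -> computable_fun F2 ->
  computable_fun (fun n => G (F1 n) (F2 n)).
Proof.
move=> cG cF1 cF2; have := computable_comp cG (computable_npair cF1 cF2).
by apply: computable_ext => n; rewrite !npairE.
Qed.

(** The primitive recursion of [cprec] carries a single parameter [nfst n]; the
   whole input is passed as that parameter, so that bound, base and step may all
   depend on it. *)
Lemma computable_rec (K X : nat -> nat) (G : nat -> nat -> nat -> nat) :
  computable_fun K -> computable_fun X ->
  computable_fun (fun m => G (nfst m) (nfst (nsnd m)) (nsnd (nsnd m))) ->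
  computable_fun (fun n => nat_rect (fun=> nat) (X n) (G n) (K n)).
Proof.
move=> cK [a aX] [b bG].
pose R x k := nat_rect (fun=> nat) (X x) (G x) k.
have cR : computable_fun (fun m => R (nfst m) (nsnd m)).
  exists (cprec a b) => m /=.
  elim: (nsnd m) => [|i IHi] /=; first exact: aX.
  exists (R (nfst m) i) => //.
  by have := bG (npair (nfst m) (npair i (R (nfst m) i))); rewrite !npairE.
have := computable_comp cR (computable_npair computable_id cK).
by apply: computable_ext => n; rewrite !npairE.
Qed.

Lemma computable_iter (K X : nat -> nat) (G : nat -> nat -> nat) :
  computable_fun K -> computable_fun X ->
  computable2 G ->
  computable_fun (fun n => iter (K n) (G n) (X n)).
Proof.
move=> cK cX cG.
apply: (@computable_ext (fun n => nat_rect (fun=> nat) (X n) (fun=> G n) (K n))).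
  by move=> n; elim: (K n) => //= i ->.
apply: (@computable_rec K X (fun n _ y => G n y)) => //.
apply: computable_comp2 => //; first exact/computable_nfst/computable_id.
exact/computable_nsnd/computable_nsnd/computable_id.
Qed.

(** A conditional is an iteration of length zero or one. *)
Lemma computable_if (b : nat -> bool) F G :
  computable_fun (fun n => b n : nat) -> computable_fun F -> computable_fun G ->
  computable_fun (fun n => if b n then F n else G n).
Proof.
move=> cb cF cG.
apply: (@computable_ext (fun n => iter (b n) (fun=> F n) (G n))).
  by move=> n; case: (b n).
by apply: computable_iter => //; apply: (computable_comp cF); apply/computable_nfst/computable_id.
Qed.

Lemma computable_pred F : computable_fun F -> computable_fun (fun n => (F n).-1).
Proof.
move=> cF.
apply: (@computable_ext (fun n => nat_rect (fun=> nat) 0 (fun i _ => i) (F n))).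
  by move=> n; case: (F n).
apply: (@computable_rec F (fun=> 0) (fun _ i _ => i)) => //; first exact: computable_const.
exact/computable_nfst/computable_nsnd/computable_id.
Qed.

Lemma computable_add F G :
  computable_fun F -> computable_fun G -> computable_fun (fun n => F n + G n).
Proof.
move=> cF cG; apply: (@computable_ext (fun n => iter (F n) succn (G n))).
  by move=> n; rewrite iter_succn addnC.
apply: computable_iter => //.
exact/computable_succ/computable_nsnd/computable_id.
Qed.

Lemma computable_sub F G :
  computable_fun F -> computable_fun G -> computable_fun (fun n => F n - G n).
Proof.
move=> cF cG; apply: (@computable_ext (fun n => iter (G n) predn (F n))).
  by move=> n; rewrite iter_predn.
apply: computable_iter => //.
exact/computable_pred/computable_nsnd/computable_id.
Qed.

Lemma computable_eq0 F : computable_fun F -> computable_fun (fun n => (F n == 0) : nat).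
Proof.
move=> cF; apply: (@computable_ext (fun n => 1 - F n)); first by move=> n; case: (F n) => // -[].
by apply: computable_sub => //; exact: computable_const.
Qed.

Lemma computable_leq F G :
  computable_fun F -> computable_fun G -> computable_fun (fun n => (F n <= G n) : nat).
Proof. by move=> cF cG; apply: computable_eq0; apply: computable_sub. Qed.

Lemma computable_negb (b : nat -> bool) :
  computable_fun (fun n => b n : nat) -> computable_fun (fun n => ~~ b n : nat).
Proof.
move=> cb; apply: (@computable_ext (fun n => (b n : nat) == 0 : nat)).
  by move=> n; case: (b n).
exact: computable_eq0.
Qed.

Lemma computable_andb (b c : nat -> bool) :
  computable_fun (fun n => b n : nat) -> computable_fun (fun n => c n : nat) ->
  computable_fun (fun n => b n && c n : nat).
Proof.
move=> cb cc; apply: (@computable_ext (fun n => if b n then (c n : nat) else 0)).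
  by move=> n; case: (b n).
by apply: computable_if => //; exact: computable_const.
Qed.

Lemma computable_orb (b c : nat -> bool) :
  computable_fun (fun n => b n : nat) -> computable_fun (fun n => c n : nat) ->
  computable_fun (fun n => b n || c n : nat).
Proof.
move=> cb cc; apply: (@computable_ext (fun n => if b n then 1 else (c n : nat))).
  by move=> n; case: (b n).
by apply: computable_if => //; exact: computable_const.
Qed.

Lemma computable_eq F G :
  computable_fun F -> computable_fun G -> computable_fun (fun n => (F n == G n) : nat).
Proof.
move=> cF cG; apply: (@computable_ext (fun n => (F n <= G n) && (G n <= F n) : nat)).
  by move=> n; rewrite eqn_leq.
by apply: computable_andb; apply: computable_leq.
Qed.

Lemma computable_sum (K : nat -> nat) (G : nat -> nat -> nat) :
  computable_fun K -> computable2 G ->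
  computable_fun (fun n => \sum_(k < K n) G n k).
Proof.
move=> cK cG.
apply: (@computable_ext (fun n => nat_rect (fun=> nat) 0 (fun k y => y + G n k) (K n))).
  by move=> n; elim: (K n) => [|k IHk] /=; rewrite ?big_ord0 // big_ord_recr IHk.
apply: (@computable_rec K (fun=> 0) (fun n k y => y + G n k)) => //.
  exact: computable_const.
apply: computable_add; first exact/computable_nsnd/computable_nsnd/computable_id.
apply: computable_comp2 => //; first exact/computable_nfst/computable_id.
exact/computable_nfst/computable_nsnd/computable_id.
Qed.

End Closure.

(** * The tree of finite sequences *)

(** Finite sequences are coded with their last entry outermost, [0] being the
   empty one. Every number codes exactly one sequence, and the prefixes of a
   sequence are the iterated parents of its code. *)
Definition child p v := (npair p v).+1.
Definition parent s := nfst s.-1.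
Definition label s := nsnd s.-1.
(** The count may stop at [s] because a code is at least as large as the length
   of its sequence; a bounded sum keeps the definition primitive recursive. *)
Definition depth s := \sum_(k < s) (iter k parent s != 0).
(** The prefix order. *)
Definition anc s t := iter (depth t - depth s) parent t == s.
(** The sequence as a partial oracle: [0] stands for an undefined value and
   [v.+1] for the value [v]. *)
Definition lookup s q :=
  if q < depth s then (label (iter (depth s - q.+1) parent s)).+1 else 0.

Lemma parent_child p v : parent (child p v) = p.
Proof. by rewrite /parent nfst_pair. Qed.

Lemma label_child p v : label (child p v) = v.
Proof. by rewrite /label nsnd_pair. Qed.

Lemma child_eta s : s != 0 -> child (parent s) (label s) = s.
Proof. by case: s => // s _; rewrite /child npair_eta. Qed.

Lemma parent0 : parent 0 = 0.
Proof. by apply/eqP; rewrite -leqn0 -{2}(npair_eta 0) leq_npair. Qed.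

Lemma iter_parent0 k : iter k parent 0 = 0.
Proof. by elim: k => //= k ->; exact: parent0. Qed.

Lemma ltn_child p v : p < child p v.
Proof. by rewrite ltnS leq_npair. Qed.

Lemma node_ind (P : nat -> Prop) :
  P 0 -> (forall p v, P p -> P (child p v)) -> forall s, P s.
Proof.
move=> P0 Pchild s; have [n] := ubnP s; elim: n s => // n IHn [|s] // ltsn.
rewrite -(@child_eta s.+1) //; apply: Pchild; apply: IHn.
rewrite -ltnS (leq_trans _ ltsn) // ltnS -{2}(@child_eta s.+1) //.
exact: ltn_child.
Qed.

Lemma iter_parent_self s k : s <= k -> iter k parent s = 0.
Proof.
elim/node_ind: s k => [|p v IHp] k; first by rewrite iter_parent0.
case: k => [|k lek]; first by rewrite ltn0.
by rewrite iterSr parent_child IHp // -ltnS (leq_trans (ltn_child p v)).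
Qed.

Lemma depth0 : depth 0 = 0.
Proof. by rewrite /depth big_ord0. Qed.

Lemma depth_child p v : depth (child p v) = (depth p).+1.
Proof.
rewrite /depth big_ord_recl /= add1n; congr _.+1.
under eq_bigr => k _ do rewrite add0n -iterS iterSr parent_child.
rewrite -(subnKC (leq_npair p v)) big_split_ord /= [X in _ + X]big1 ?addn0 //.
by move=> k _; rewrite iter_parent_self // leq_addr.
Qed.

Lemma depth_iter k s : depth (iter k parent s) = depth s - k.
Proof.
elim: k s => [|k IHk] s; first by rewrite subn0.
rewrite iterSr IHk; elim/node_ind: s => [|p v _].
  by rewrite parent0 depth0 !sub0n.
by rewrite parent_child depth_child subSS.
Qed.

Lemma depth_eq0 s : depth s = 0 -> s = 0.
Proof. by elim/node_ind: s => // p v _; rewrite depth_child. Qed.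

Lemma ancP s t : reflect (exists k, iter k parent t = s) (anc s t).
Proof.
apply: (iffP eqP) => [<-|[k <-]]; first by exists (depth t - depth s).
rewrite depth_iter; have [lekt|ltkt] := leqP k (depth t); first by rewrite subKn.
have: depth (iter k parent t) = 0 by rewrite depth_iter; apply/eqP; rewrite subn_eq0 ltnW.
move/depth_eq0=> ->; apply: depth_eq0; rewrite depth_iter.
by move/ltnW/eqP: ltkt => ->; rewrite subn0 subnn.
Qed.

Lemma anc_refl s : anc s s.
Proof. by apply/ancP; exists 0. Qed.

Lemma anc_trans s t u : anc s t -> anc t u -> anc s u.
Proof.
by move=> /ancP[k <-] /ancP[j <-]; apply/ancP; exists (k + j); rewrite iterD.
Qed.

Lemma parent_leq s : parent s <= s.
Proof.
by elim/node_ind: s => [|p v _]; rewrite ?parent0 // parent_child ltnW ?ltn_child.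
Qed.

Lemma anc_leq s t : anc s t -> s <= t.
Proof.
move=> /ancP[k <-]; elim: k => //= k; exact/leq_trans/parent_leq.
Qed.

Lemma anc0s s : anc 0 s.
Proof. by apply/ancP; exists s; rewrite iter_parent_self. Qed.

Lemma anc_child s p v : anc s (child p v) = (s == child p v) || anc s p.
Proof.
apply/ancP/orP => [[[|k] <-]|[/eqP->|/ancP[k <-]]]; first by left.
- by right; apply/ancP; exists k; rewrite iterSr parent_child.
- by exists 0.
- by exists k.+1; rewrite iterSr parent_child.
Qed.

(** The prefixes of one sequence form a chain. *)
Lemma anc_total s t u : anc s u -> anc t u -> anc s t || anc t s.
Proof.
elim/node_ind: u => [|p v IHp].
  by move=> /anc_leq; rewrite leqn0 => /eqP-> _; rewrite anc0s.
rewrite !anc_child => /predU1P[->|sp] /predU1P[->|tp]; last exact: IHp.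
- by rewrite anc_refl.
- by rewrite anc_child tp !orbT.
- by rewrite anc_child sp orbT.
Qed.

Lemma anc_strict s t : anc s t -> s != t -> exists v, anc (child s v) t.
Proof.
elim/node_ind: t => [|p v IHp].
  by move=> /anc_leq; rewrite leqn0 => ->.
rewrite anc_child => /predU1P[->|sp _]; first by rewrite eqxx.
have [->|/(IHp sp)[w wp]] := eqVneq s p; first by exists v; exact: anc_refl.
by exists w; rewrite anc_child wp orbT.
Qed.

(** The longest common prefix. *)
Lemma anc_meet s t : exists u,
  [/\ anc u s, anc u t & forall w, anc w s -> anc w t -> anc w u].
Proof.
elim/node_ind: t => [|p v [u [us up maxu]]].
  by exists 0; split; rewrite ?anc0s.
have [chs|chNs] := boolP (anc (child p v) s).
  by exists (child p v); split=> //; exact: anc_refl.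
exists u; split=> //; first by rewrite anc_child up orbT.
move=> w ws; rewrite anc_child => /predU1P[ew|]; last exact: maxu.
by rewrite -ew ws in chNs.
Qed.

Lemma lookup_child p v q :
  lookup (child p v) q = if q == depth p then v.+1 else lookup p q.
Proof.
rewrite /lookup depth_child ltnS leq_eqVlt; case: eqP => [->|_] /=.
  by rewrite subnn label_child.
by case: ltnP => // ltqp; rewrite subSS -subnSK // iterSr parent_child.
Qed.

Lemma lookup_above s q : depth s <= q -> lookup s q = 0.
Proof. by rewrite /lookup ltnNge => ->. Qed.

Lemma anc_lookup s t q : anc s t -> lookup s q != 0 -> lookup t q = lookup s q.
Proof.
elim/node_ind: t => [|p v IHp]; first by move=> /anc_leq; rewrite leqn0 => /eqP->.
rewrite anc_child => /predU1P[->//|sp] sq; rewrite lookup_child.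
rewrite -(IHp sp) // ifN //; apply: contraNneq sq => ->.
have -> : lookup s (depth p) = 0; last by [].
apply: lookup_above; move: sp => /ancP[k <-]; rewrite depth_iter; exact: leq_subr.
Qed.

Fixpoint segment (f : nat -> nat) k :=
  if k is j.+1 then child (segment f j) (f j) else 0.

Lemma depth_segment f k : depth (segment f k) = k.
Proof. by elim: k => [|k IHk] /=; rewrite ?depth0 // depth_child IHk. Qed.

Lemma leq_segment f k : k <= segment f k.
Proof. by elim: k => //= k IHk; rewrite (leq_ltn_trans IHk) // ltn_child. Qed.

Lemma anc_segment f j k : j <= k -> anc (segment f j) (segment f k).
Proof.
elim: k => [|k IHk]; first by rewrite leqn0 => /eqP->; exact: anc_refl.
rewrite leq_eqVlt => /predU1P[->|ltjk]; first exact: anc_refl.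
by rewrite anc_child IHk ?orbT.
Qed.

Lemma lookup_segment f k q :
  lookup (segment f k) q = if q < k then (f q).+1 else 0.
Proof.
elim: k => [|k IHk]; first by rewrite lookup_above // depth0.
rewrite lookup_child depth_segment IHk ltnS [q <= k]leq_eqVlt.
by case: eqP => [->|].
Qed.

Lemma computable_parent F : computable_fun F -> computable_fun (fun n => parent (F n)).
Proof. by move=> cF; apply/computable_nfst/computable_pred. Qed.

Lemma computable_depth F : computable_fun F -> computable_fun (fun n => depth (F n)).
Proof.
apply: computable_comp.
apply: (@computable_sum id (fun s k => iter k parent s != 0)); first exact: computable_id.
apply: computable_negb; apply: computable_eq0; apply: computable_iter.
- exact/computable_nsnd/computable_id.
- exact/computable_nfst/computable_id.
- exact/computable_parent/computable_nsnd/computable_id.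
Qed.

(** Proves that a composite is computable from the shape of the expression. The
   matching is purely syntactic: unification up to conversion would look for
   the closure lemmas inside unfolded definitions. *)
Ltac computable_step :=
  lazymatch goal with
  | |- computable2 _ => rewrite /computable2
  | |- computable_fun (fun n => n) => exact: computable_id
  | |- computable_fun (fun=> ?c) => exact: computable_const
  | |- computable_fun (fun n => (@?F n).+1) => apply: (@computable_succ F)
  | |- computable_fun (fun n => (@?F n).-1) => apply: (@computable_pred F)
  | |- computable_fun (fun n => nfst (@?F n)) => apply: (@computable_nfst F)
  | |- computable_fun (fun n => nsnd (@?F n)) => apply: (@computable_nsnd F)
  | |- computable_fun (fun n => npair (@?F n) (@?G n)) => apply: (@computable_npair F G)
  | |- computable_fun (fun n => @?F n - @?G n) => apply: (@computable_sub F G)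
  | |- computable_fun (fun n => nat_of_bool (@?F n == @?G n)) =>
      apply: (@computable_eq F G)
  | |- computable_fun (fun n => nat_of_bool (@?F n <= @?G n)) =>
      apply: (@computable_leq F G)
  | |- computable_fun (fun n => nat_of_bool (~~ @?b n)) => apply: (@computable_negb b)
  | |- computable_fun (fun n => nat_of_bool (@?b n && @?c n)) =>
      apply: (@computable_andb b c)
  | |- computable_fun (fun n => nat_of_bool (@?b n || @?c n)) =>
      apply: (@computable_orb b c)
  | |- computable_fun (fun n => parent (@?F n)) => apply: (@computable_parent F)
  | |- computable_fun (fun n => depth (@?F n)) => apply: (@computable_depth F)
  | |- computable_fun (fun n => iter (@?K n) parent (@?X n)) =>
      apply: (@computable_iter K X (fun=> parent))
  | |- computable_fun (fun=> if _ then _ else _) => apply: computable_if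
  | |- computable_fun nsnd => exact: (computable_nsnd computable_id)
  | |- _ => assumption
  end.

Ltac computable := repeat (computable_step; cbv beta).

Lemma computable_anc : computable2 anc.
Proof. by rewrite /anc; computable. Qed.

Lemma computable_lookup : computable2 lookup.
Proof. by rewrite /lookup /label; computable. Qed.

(** * A stack machine *)

(** A state of the machine is [npair K v], with [K] a control stack and [v] the
   current value. The items of the stack are tagged numbers: instructions, which
   are to be applied to the current value, and the four kinds of frames below,
   which wait for the value of a subcomputation. Stacks are coded so that [0] is
   the empty stack, on which the machine has halted. *)
Definition push h K := (npair h K).+1.

(** [pair_left b v] awaits the first component and still has to run [b] on [v];
   [pair_right x] awaits the second one. In [prec_frame b x i d] the awaited
   value is that of the recursion at [i], and [d] rounds remain; in
   [mu_frame a x i] it is the value of [a] at the candidate [i]. *)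
Definition pair_left b v := npair 9 (npair b v).
Definition pair_right x := npair 10 x.
Definition prec_frame b x i d := npair 11 (npair (npair b x) (npair i d)).
Definition mu_frame a x i := npair 12 (npair a (npair x i)).

Fixpoint instr (e : code) : nat :=
  match e with
  | czero => npair 0 0
  | csucc => npair 1 0
  | cfst => npair 2 0
  | csnd => npair 3 0
  | coracle => npair 4 0
  | cpair a b => npair 5 (npair (instr a) (instr b))
  | ccomp a b => npair 6 (npair (instr a) (instr b))
  | cprec a b => npair 7 (npair (instr a) (instr b))
  | cmu a => npair 8 (instr a)
  end.

(** One transition of the machine in state [st], whose top item has tag [t] and
   payload [p], with [r] the rest of the stack and [v] the current value.
   The answer [w] to the oracle query [v] is [0] when it is undefined, and
   then a query leaves the state unchanged. *)
Definition exec (w st r v t p : nat) : nat :=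
  if t == 0 then npair r 0 else
  if t == 1 then npair r v.+1 else
  if t == 2 then npair r (nfst v) else
  if t == 3 then npair r (nsnd v) else
  if t == 4 then (if w == 0 then st else npair r w.-1) else
  if t == 5 then npair (push (nfst p) (push (pair_left (nsnd p) v) r)) v else
  if t == 6 then npair (push (nsnd p) (push (nfst p) r)) v else
  if t == 7 then
    npair (push (nfst p) (push (prec_frame (nsnd p) (nfst v) 0 (nsnd v)) r)) (nfst v)
  else
  if t == 8 then npair (push p (push (mu_frame p v 0) r)) (npair v 0) else
  if t == 9 then npair (push (nfst p) (push (pair_right v) r)) (nsnd p) else
  if t == 10 then npair r (npair p v) else
  if t == 11 then
    if nsnd (nsnd p) == 0 then npair r v
    else npair (push (nfst (nfst p)) (push (prec_frame (nfst (nfst p)) (nsnd (nfst p))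
                  (nfst (nsnd p)).+1 (nsnd (nsnd p)).-1) r))
           (npair (nsnd (nfst p)) (npair (nfst (nsnd p)) v))
  else
    if v == 0 then npair r (nsnd (nsnd p))
    else npair (push (nfst p) (push (mu_frame (nfst p) (nfst (nsnd p))
                  (nsnd (nsnd p)).+1) r))
           (npair (nfst (nsnd p)) (nsnd (nsnd p)).+1).

Definition step (w st : nat) : nat :=
  if nfst st == 0 then st
  else exec w st (nsnd (nfst st).-1) (nsnd st)
         (nfst (nfst (nfst st).-1)) (nsnd (nfst (nfst st).-1)).

Lemma step_push w h K v :
  step w (npair (push h K) v) = exec w (npair (push h K) v) K v (nfst h) (nsnd h).
Proof.
rewrite /step nfst_pair nsnd_pair -[(push h K).-1]/(npair h K) nfst_pair nsnd_pair.
by have -> : (push h K == 0) = false by [].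
Qed.

Definition ostep (o : nat -> nat) st := step (o (nsnd st)) st.
Definition halted st := nfst st == 0.
Definition start e n := npair (push e 0) n.

Lemma ostep_halted o st k : halted st -> iter k (ostep o) st = st.
Proof. by move=> h; elim: k => //= k ->; rewrite /ostep /step (eqP h). Qed.

Lemma halted_leq o st j k :
  j <= k -> halted (iter j (ostep o) st) -> halted (iter k (ostep o) st).
Proof. by move=> lejk h; rewrite -(subnK lejk) iterD ostep_halted. Qed.

(** An undefined oracle value either blocks the machine for good or is not
   consulted at all. *)
Lemma step_undefined st : step 0 st = st \/ forall w, step w st = step 0 st.
Proof.
rewrite /step; case: (nfst st == 0); first by left.
by case: (nfst (nfst _)) => [|[|[|[|[|t]]]]]; [right..|left|right].
Qed.

(** A halting run has never met an undefined value, so it is also the run of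
   every more defined oracle. *)
Lemma halted_extend (o o' : nat -> nat) st k :
  (forall q, o q != 0 -> o' q = o q) ->
  halted (iter k (ostep o) st) -> halted (iter k (ostep o') st).
Proof.
move=> oo'; elim: k st => [|k IHk] st; first exact.
rewrite !iterSr => h.
have [o0|/oo' o'q] := eqVneq (o (nsnd st)) 0; last first.
  by rewrite {2}/ostep o'q; apply: IHk.
have [stuck|free] := step_undefined st.
  rewrite -iterSr; apply: (@halted_leq _ _ 0); first exact: leq0n.
  have fix_st : ostep o st = st by rewrite /ostep o0.
  by move: h; rewrite -iterSr (iter_fix _ fix_st).
by rewrite {2}/ostep free; apply: IHk; move: h; rewrite {2}/ostep o0.
Qed.

(** A halting run consults the oracle at finitely many places. *)
Lemma halted_use (f : nat -> nat) st k :
  halted (iter k (ostep (fun q => (f q).+1)) st) ->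
  exists b, forall o, (forall q, q < b -> o q = (f q).+1) ->
    halted (iter k (ostep o) st).
Proof.
elim: k st => [|k IHk] st; first by exists 0.
rewrite iterSr => /IHk[b hb]; exists (maxn b (nsnd st).+1) => o oE.
rewrite iterSr {2}/ostep oE ?leq_maxr //; apply: hb => q ltqb.
by apply: oE; rewrite leq_max ltqb.
Qed.

Section Correctness.

Variable f : nat -> nat.

(* Under a total oracle every query is answered. *)
Let stp := ostep (fun q => (f q).+1).

Lemma stp_push h K v : stp (npair (push h K) v) =
  exec (f v).+1 (npair (push h K) v) K v (nfst h) (nsnd h).
Proof. by rewrite /stp /ostep nsnd_pair step_push. Qed.

Ltac run := rewrite stp_push /= ?npairE /exec /= ?npairE.

Lemma stp_zero K v : stp (npair (push (instr czero) K) v) = npair K 0.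
Proof. by run. Qed.

Lemma stp_succ K v : stp (npair (push (instr csucc) K) v) = npair K v.+1.
Proof. by run. Qed.

Lemma stp_fst K v : stp (npair (push (instr cfst) K) v) = npair K (nfst v).
Proof. by run. Qed.

Lemma stp_snd K v : stp (npair (push (instr csnd) K) v) = npair K (nsnd v).
Proof. by run. Qed.

Lemma stp_oracle K v : stp (npair (push (instr coracle) K) v) = npair K (f v).
Proof. by run. Qed.

Lemma stp_pair a b K v : stp (npair (push (instr (cpair a b)) K) v) =
  npair (push (instr a) (push (pair_left (instr b) v) K)) v.
Proof. by run. Qed.

Lemma stp_pair_left b x K v : stp (npair (push (pair_left b x) K) v) =
  npair (push b (push (pair_right v) K)) x.
Proof. by run. Qed.

Lemma stp_pair_right x K v : stp (npair (push (pair_right x) K) v) =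
  npair K (npair x v).
Proof. by run. Qed.

Lemma stp_comp a b K v : stp (npair (push (instr (ccomp a b)) K) v) =
  npair (push (instr b) (push (instr a) K)) v.
Proof. by run. Qed.

Lemma stp_prec a b K v : stp (npair (push (instr (cprec a b)) K) v) =
  npair (push (instr a) (push (prec_frame (instr b) (nfst v) 0 (nsnd v)) K)) (nfst v).
Proof. by run. Qed.

Lemma stp_prec_frame0 b x i K v : stp (npair (push (prec_frame b x i 0) K) v) =
  npair K v.
Proof. by run. Qed.

Lemma stp_prec_frameS b x i d K v : stp (npair (push (prec_frame b x i d.+1) K) v) =
  npair (push b (push (prec_frame b x i.+1 d) K)) (npair x (npair i v)).
Proof. by run. Qed.

Lemma stp_mu a K v : stp (npair (push (instr (cmu a)) K) v) =
  npair (push (instr a) (push (mu_frame (instr a) v 0) K)) (npair v 0).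
Proof. by run. Qed.

Lemma stp_mu_frame0 a x i K : stp (npair (push (mu_frame a x i) K) 0) =
  npair K i.
Proof. by run. Qed.

Lemma stp_mu_frameS a x i K v : stp (npair (push (mu_frame a x i) K) v.+1) =
  npair (push a (push (mu_frame a x i.+1) K)) (npair x i.+1).
Proof. by run. Qed.

#[local] Opaque exec step.

Definition reaches x y := exists k, iter k stp x = y.

Lemma reaches_refl x : reaches x x.
Proof. by exists 0. Qed.

Lemma reaches_trans y x z : reaches x y -> reaches y z -> reaches x z.
Proof. by move=> [j <-] [k <-]; exists (k + j); rewrite iterD. Qed.

Lemma reaches_step x y : reaches (stp x) y -> reaches x y.
Proof. by case=> k <-; exists k.+1; rewrite iterSr. Qed.

(** Completeness of the machine: it simulates every evaluation, whatever is
   waiting on the stack. *)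
Lemma eval_reaches e n m K :
  eval f e n m -> reaches (npair (push (instr e) K) n) (npair K m).
Proof.
elim: e n m K => [|||||a IHa b IHb|a IHa b IHb|a IHa b IHb|a IHa] n m K /=.
- by move=> ->; exists 1; exact: stp_zero.
- by move=> ->; exists 1; exact: stp_succ.
- by move=> ->; exists 1; exact: stp_fst.
- by move=> ->; exists 1; exact: stp_snd.
- by move=> ->; exists 1; exact: stp_oracle.
- case=> [x [y [/IHa a_x /IHb b_y ->]]].
  apply: reaches_step; rewrite stp_pair; apply: reaches_trans (a_x _) _.
  apply: reaches_step; rewrite stp_pair_left; apply: reaches_trans (b_y _) _.
  by apply: reaches_step; rewrite stp_pair_right; exact: reaches_refl.
- case=> x /IHb b_x /IHa a_m.
  by apply: reaches_step; rewrite stp_comp; apply: reaches_trans (b_x _) (a_m _).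
- set base := eval f a (nfst n).
  set step_b := fun i y z => eval f b (npair (nfst n) (npair i y)) z.
  pose frame i d := push (prec_frame (instr b) (nfst n) i d) K.
  have loop i : forall d y, prec_graph base step_b i y ->
      reaches (npair (push (instr a) (frame 0 (i + d))) (nfst n)) (npair (frame i d) y).
    elim: i => [|i IHi] d y /=; first exact: IHa.
    case=> z /(IHi d.+1) reach_z /IHb b_y.
    rewrite addSnnS; apply: reaches_trans reach_z _.
    by apply: reaches_step; rewrite stp_prec_frameS; exact: b_y.
  move=> /(loop _ 0); rewrite addn0 => reach_m.
  apply: reaches_step; rewrite stp_prec; apply: reaches_trans reach_m _.
  by apply: reaches_step; rewrite stp_prec_frame0; exact: reaches_refl.
- case=> a_m below.
  (* Induction on the distance [d] from the candidate [i] to the answer [m]. *)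
  suff loop d : forall i, i + d = m ->
      reaches (npair (push (instr a) (push (mu_frame (instr a) n i) K)) (npair n i))
              (npair K m).
    by apply: reaches_step; rewrite stp_mu; exact: (loop m).
  elim: d => [|d IHd] i; rewrite ?addn0 ?addnS => im.
    rewrite im; apply: reaches_trans (IHa _ _ _ a_m) _.
    by apply: reaches_step; rewrite stp_mu_frame0; exact: reaches_refl.
  have [|y /IHa a_i] := below i; first by rewrite -im ltnS leq_addr.
  apply: reaches_trans (a_i _) _; apply: reaches_step; rewrite stp_mu_frameS.
  exact: IHd.
Qed.

Lemma halted_push k h K v : halted (iter k stp (npair (push h K) v)) ->
  exists2 j, j < k & halted (iter j stp (stp (npair (push h K) v))).
Proof.
case: k => [|k]; last by rewrite iterSr; exists k.
by rewrite /= /halted nfst_pair.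
Qed.

(** The next two lemmas follow the loops of a halting run. The number of
   remaining steps strictly decreases, which bounds the rounds of an unbounded
   search; the hypothesis on the body is the induction hypothesis of
   [halted_eval]. *)
Lemma prec_loop_halted b x K (base : nat -> Prop) :
  (forall n K' k, halted (iter k stp (npair (push (instr b) K') n)) ->
    exists m j, [/\ j < k, eval f b n m & halted (iter j stp (npair K' m))]) ->
  forall d i y k,
  let step_b i y z := eval f b (npair x (npair i y)) z in
  prec_graph base step_b i y ->
  halted (iter k stp (npair (push (prec_frame (instr b) x i d) K) y)) ->
  exists m j, [/\ j < k, prec_graph base step_b (i + d) m &
    halted (iter j stp (npair K m))].
Proof.
move=> IHb; elim=> [|d IHd] i y k step_b graph_y /halted_push[k1 lt1].
  by rewrite stp_prec_frame0 addn0; exists y, k1.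
rewrite stp_prec_frameS => /IHb[z [k2 [lt2 b_z /IHd]]].
case=> [|m [k3 [lt3 graph_m h]]]; first by exists y.
exists m, k3; split=> //; last by rewrite -addSnnS.
exact/(ltn_trans lt3)/(ltn_trans lt2).
Qed.

Lemma mu_loop_halted a x K :
  (forall n K' k, halted (iter k stp (npair (push (instr a) K') n)) ->
    exists m j, [/\ j < k, eval f a n m & halted (iter j stp (npair K' m))]) ->
  forall k i y,
  (forall j, j < i -> exists z, eval f a (npair x j) z.+1) ->
  eval f a (npair x i) y ->
  halted (iter k stp (npair (push (mu_frame (instr a) x i) K) y)) ->
  exists m j, [/\ j < k, eval f (cmu a) x m & halted (iter j stp (npair K m))].
Proof.
move=> IHa; elim/ltn_ind=> k IHk i [|y] below a_y /halted_push[k1 lt1].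
  by rewrite stp_mu_frame0; exists i, k1.
rewrite stp_mu_frameS => /IHa[z [k2 [lt2 a_z]]].
have lt2k := ltn_trans lt2 lt1.
case/IHk=> // [j|m [k3 [lt3 mu_m h]]].
  by rewrite ltnS leq_eqVlt => /predU1P[->|/below //]; exists y.
by exists m, k3; split=> //; exact: ltn_trans lt3 lt2k.
Qed.

(** Soundness of the machine: a run can halt only after it has popped the
   instruction [e], and then it has computed a value of [e]. *)
Lemma halted_eval e n K k :
  halted (iter k stp (npair (push (instr e) K) n)) ->
  exists m j, [/\ j < k, eval f e n m & halted (iter j stp (npair K m))].
Proof.
elim: e n K k => [|||||a IHa b IHb|a IHa b IHb|a IHa b IHb|a IHa] n K k
  /halted_push[k1 lt1].
- by rewrite stp_zero; exists 0, k1.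
- by rewrite stp_succ; exists n.+1, k1.
- by rewrite stp_fst; exists (nfst n), k1.
- by rewrite stp_snd; exists (nsnd n), k1.
- by rewrite stp_oracle; exists (f n), k1.
- rewrite stp_pair => /IHa[x [k2 [lt2 a_x /halted_push[k3 lt3]]]].
  rewrite stp_pair_left => /IHb[y [k4 [lt4 b_y /halted_push[k5 lt5]]]].
  rewrite stp_pair_right; exists (npair x y), k5; split=> //; last by exists x, y.
  exact/(ltn_trans lt5)/(ltn_trans lt4)/(ltn_trans lt3)/(ltn_trans lt2).
- rewrite stp_comp => /IHb[x [k2 [lt2 b_x /IHa[m [k3 [lt3 a_m h]]]]]].
  exists m, k3; split=> //; last by exists x.
  exact/(ltn_trans lt3)/(ltn_trans lt2).
- rewrite stp_prec => /IHa[x [k2 [lt2 a_x]]].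
  case/(prec_loop_halted IHb (base := eval f a (nfst n)) (i := 0)) => // m [k3 [lt3 graph_m h]].
  exists m, k3; split=> //; exact/(ltn_trans lt3)/(ltn_trans lt2).
- rewrite stp_mu => /IHa[y [k2 [lt2 a_y]]].
  case/(mu_loop_halted IHa) => // m [k3 [lt3 mu_m h]].
  exists m, k3; split=> //; exact/(ltn_trans lt3)/(ltn_trans lt2).
Qed.

Lemma haltsP e n :
  halts f e n <-> exists k, halted (iter k stp (start (instr e) n)).
Proof.
split=> [[m /(@eval_reaches _ _ _ 0)[k e_k]]|[k /halted_eval[m [_ [_ ev _]]]]].
  by exists k; rewrite e_k /halted npairE.
by exists m.
Qed.

End Correctness.

Lemma computable_step : computable2 step.
Proof.
rewrite /step /exec /push /pair_left /pair_right /prec_frame /mu_frame.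
by computable.
Qed.

(** * Computation trees *)

(** Membership of [s] in the computation tree of the index [i], a pair of a program and
   an input. The bound [s] on the number of steps is at least the length of the
   sequence [s], so it tends to infinity along every path. *)
Definition survives i s :=
  ~~ halted (iter s (ostep (lookup s)) (start (nfst i) (nsnd i))).

Lemma survives_anc i s t : anc s t -> survives i t -> survives i s.
Proof.
move=> st; apply: contra => /(halted_leq (anc_leq st)).
by apply: halted_extend => q; exact: anc_lookup.
Qed.

(** The infinite paths of the computation tree are the oracles that make the
   computation diverge. A halting computation is detected by every prefix
   that is longer than both its running time and its use. *)
Lemma survives_path f e n :
  (forall k, survives (npair (instr e) n) (segment f k)) <-> ~ halts f e n.
Proof.
rewrite /survives !npairE haltsP; split=> [surv [k hk]|nhalt k].
  have [b use_b] := halted_use hk.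
  have /negP[] := surv (maxn b k).
  apply: (@halted_leq _ _ k); first exact/(leq_trans (leq_maxr b k))/leq_segment.
  by apply: use_b => q ltqb; rewrite lookup_segment leq_max ltqb.
apply/negP => hk; apply: nhalt; exists (segment f k).
apply: halted_extend hk => q; rewrite lookup_segment.
by case: ifP.
Qed.

Lemma survives_never e n s :
  (forall f, ~ halts f e n) -> survives (npair (instr e) n) s.
Proof.
move=> never; rewrite /survives !npairE; apply/negP => hs.
apply: (never (fun q => (lookup s q).-1)); apply/haltsP; exists s.
by apply: halted_extend hs => q; case: (lookup s q).
Qed.

Lemma computable_survives : computable2 (fun i s => survives i s : nat).
Proof.
rewrite /computable2 /survives /halted; computable.
apply: computable_iter; computable.
  by rewrite /start /push; computable.
rewrite /ostep; apply: (computable_comp2 computable_step); computable.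
by apply: (computable_comp2 computable_lookup); computable.
Qed.

(** * Complete lattices from well-founded meets *)

(** Starting from any element [x], meeting it with a member of [S] that is not
   above it gives a strictly smaller element with the same lower bounds jointly
   with [S]; by well-foundedness this stops, at the infimum. Suprema are infima of
   sets of upper bounds. *)
Lemma wf_meet_complete (le : rel nat) (top : nat) :
  reflexive le -> transitive le -> (forall x, le x top) ->
  (forall x y, exists m, is_inf le [set x; y] m) ->
  well_founded (fun x y => le x y && ~~ le y x) ->
  complete_lattice le.
Proof.
move=> le_refl le_trans le_top meets wf.
have infs S : exists m, is_inf le S m.
  suff infU x : exists m, is_inf le (x |` S) m.
    have [m [lbm maxm]] := infU top; exists m; split=> [y Sy|u lbu].
      by apply: lbm; right.
    by apply: maxm => y [->|/lbu].
  elim/(well_founded_ind wf): x => x IHx.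
  have [lbx|/existsNP[y /not_implyP[Sy /negP yNx]]] := pselect (forall y, S y -> le x y).
    by exists x; split=> [y [->|/lbx]|u]; [exact: le_refl | | apply; left].
  have [x' [lbx' maxx']] := meets x y.
  have x'x : le x' x by apply: lbx'; left.
  have x'y : le x' y by apply: lbx'; right.
  have [|m [lbm maxm]] := IHx x'.
    by rewrite x'x; apply: contra yNx => /le_trans; apply.
  exists m; split=> [z [->|Sz]|u lbu].
  - by apply: le_trans x'x; apply: lbm; left.
  - by apply: lbm; right.
  - apply: maxm => z [->|Sz]; last by apply: lbu; right.
    by apply: maxx' => _ [] ->; apply: lbu; [left | right].
move=> S; split; last exact: infs.
have [s [lbs maxs]] := infs [set u | forall x, S x -> le x u].
exists s; split=> [x Sx|u ubu]; last exact: lbs.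
by apply: maxs => u; apply.
Qed.

(** * Horizontal sum of capped trees *)

Inductive elt := Bot | Top | Cap of nat | Node of nat & nat.

Definition elt_of (x : nat) : elt :=
  match x with
  | 0 => Bot
  | 1 => Top
  | y.+2 => if nsnd y is s.+1 then Node (nfst y) s else Cap (nfst y)
  end.

Definition nat_of (a : elt) : nat :=
  match a with
  | Bot => 0
  | Top => 1
  | Cap i => (npair i 0).+2
  | Node i s => (npair i s.+1).+2
  end.

Lemma nat_ofK : cancel nat_of elt_of.
Proof. by case=> [||i|i s] //=; rewrite !npairE. Qed.

Lemma elt_ofK : cancel elt_of nat_of.
Proof.
move=> [|[|y]] //=; rewrite -[in RHS](npair_eta y).
by case: (nsnd y).
Qed.

Section Forest.

Variable T : nat -> nat -> bool.
Hypothesis T_anc : forall i s t, anc s t -> T i t -> T i s.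

(** A node outside its tree is comparable only to itself, [Bot] and [Top]. For
   nodes the condition is on the larger one, as [T] is closed under prefixes. *)
Definition elt_le a b : bool :=
  match a, b with
  | Bot, _ | _, Top => true
  | Cap i, Cap j => i == j
  | Node i s, Cap j => (i == j) && T i s
  | Node i s, Node j t => (i == j) && ((s == t) || anc s t && T i t)
  | _, _ => false
  end.

Definition forest_le : rel nat := fun x y => elt_le (elt_of x) (elt_of y).

Lemma node_le_anc i s t : (s == t) || anc s t && T i t -> anc s t.
Proof. by move=> /predU1P[->|/andP[]] //; rewrite anc_refl. Qed.

Lemma elt_le_refl : reflexive elt_le.
Proof. by case=> [||i|i s] //=; rewrite !eqxx. Qed.

Lemma elt_le_trans : transitive elt_le.
Proof.
move=> [||j|j t] [||i|i s] [||k|k u] //=.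
- by move=> /eqP-> /eqP->.
- by move=> /andP[/eqP-> Ts] /eqP<-; rewrite eqxx.
- move=> /andP[/eqP-> /predU1P[->//|/andP[ts Tt]]] /andP[/eqP<- _].
  by rewrite eqxx (T_anc ts Tt).
- move=> /andP[/eqP-> /predU1P[->//|/andP[st Tt]]].
  move=> /andP[/eqP<- /predU1P[<-|/andP[tu ->]]]; first by rewrite eqxx st Tt orbT.
  by rewrite eqxx (anc_trans st tu) orbT.
Qed.

Lemma elt_le_anti a b : elt_le a b -> elt_le b a -> a = b.
Proof.
case: a b => [||i|i s] [||j|j t] //=; first by move=> /eqP->.
move=> /andP[/eqP-> /predU1P[->//|/andP[/anc_leq st _]]].
move=> /andP[_ /predU1P[->//|/andP[/anc_leq ts _]]].
by congr Node; apply/eqP; rewrite eqn_leq st.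
Qed.

(** Two incomparable elements with a common lower bound other than [Bot] are
   nodes of the same tree, and meet in their longest common prefix. *)
Lemma elt_meet a b : exists c,
  [/\ elt_le c a, elt_le c b &
      forall d, elt_le d a -> elt_le d b -> elt_le d c].
Proof.
have comparable x y : elt_le x y -> exists c,
    [/\ elt_le c x, elt_le c y & forall d, elt_le d x -> elt_le d y -> elt_le d c].
  by move=> xy; exists x; rewrite elt_le_refl.
have [/comparable//|abN] := boolP (elt_le a b).
have [/comparable[c [cb ca maxc]]|baN] := boolP (elt_le b a).
  by exists c; split=> // d da db; exact: maxc.
have [botP|/existsNP[d /not_implyP[da /not_implyP[db dN]]]] :=
  pselect (forall d, elt_le d a -> elt_le d b -> d = Bot).
  by exists Bot; split=> // d da db; rewrite (botP d).
have node_below i w c : T i w -> elt_le (Node i w) c ->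
    [\/ c = Top, c = Cap i | exists2 s, c = Node i s & T i s].
  case: c => [||k|k s] //= Tw; first by constructor 1.
    by move=> /andP[/eqP<-]; constructor 2.
  by move=> /andP[/eqP<- ws]; constructor 3; exists s => //; case/predU1P: ws => [<-|/andP[]].
case: d => [||i|i w] in da db dN *; first by case: dN.
- by case: a da {abN} baN => //= _; case: (b).
- by case: a b abN baN da db => [||j|j s] [||k|k t] //= abN _ /eqP ij /eqP ik; rewrite -ij -ik eqxx in abN.
have [Tw|TwN] := boolP (T i w); last first.
  have fixw c : elt_le (Node i w) c -> c = Top \/ c = Node i w.
    case: c => [||k|k s] //=; first by left.
      by rewrite (negPf TwN) andbF.
    move=> /andP[/eqP<- /predU1P[->|/andP[/T_anc ws /ws]]]; first by right.
    by rewrite (negPf TwN).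
  have [eb|eb] := fixw _ db; first by rewrite eb in abN; case: (a) abN.
  by rewrite eb da in baN.
have [ea|ea|[s ea Ts]] := node_below _ _ _ Tw da; rewrite ea in da abN baN *.
- by case: (b) baN.
- have [eb|eb|[t eb Tt]] := node_below _ _ _ Tw db; rewrite eb /= ?eqxx ?Tt // in abN baN.
- have [eb|eb|[t eb Tt]] := node_below _ _ _ Tw db; rewrite eb /= ?eqxx ?Ts // in db abN baN *.
  have [u [us ut maxu]] := anc_meet s t.
  exists (Node i u); split=> [||[||k|k v]] //=; rewrite ?eqxx /= ?us ?ut ?Ts ?Tt ?orbT //.
  move=> /andP[/eqP-> /node_le_anc vs] /andP[_ /node_le_anc vt].
  by rewrite eqxx /= (T_anc us Ts) maxu ?orbT.
Qed.

Lemma forest_le_nat_of a b : forest_le (nat_of a) (nat_of b) = elt_le a b.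
Proof. by rewrite /forest_le !nat_ofK. Qed.

(** Below a node there are only its prefixes, whose codes are smaller; above
   the nodes come only the two levels of caps and [Top]. *)
Lemma elt_wf : well_founded (fun a b => elt_le a b && ~~ elt_le b a).
Proof.
have acc_Bot : Acc (fun a b => elt_le a b && ~~ elt_le b a) Bot.
  by constructor=> a /andP[_]; case: a.
have acc_Node i s : Acc (fun a b => elt_le a b && ~~ elt_le b a) (Node i s).
  elim/ltn_ind: s => s IHs; constructor.
  case=> [||j|j t] /=; [by [] | by [] | by [] | move=> /andP[/andP[/eqP-> ts] stN]].
  apply: IHs; case/predU1P: ts stN => [->|/andP[/anc_leq]]; first by rewrite !eqxx.
  by rewrite leq_eqVlt => /predU1P[->|//]; rewrite !eqxx.
have acc_Cap i : Acc (fun a b => elt_le a b && ~~ elt_le b a) (Cap i).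
  constructor; case=> [||j|j t] jt; [exact: acc_Bot | by [] | | exact: acc_Node].
  by case/andP: jt => /eqP /= ->; rewrite eqxx.
case=> [||i|i s]; [exact: acc_Bot | | exact: acc_Cap | exact: acc_Node].
constructor; case=> [||j|j t] jt;
  [exact: acc_Bot | by [] | exact: acc_Cap | exact: acc_Node].
Qed.

Lemma forest_le_wf : well_founded (fun x y => forest_le x y && ~~ forest_le y x).
Proof.
move=> x; have [a] : exists a, elt_of x = a by exists (elt_of x).
elim/(well_founded_ind elt_wf): a x => a IHa x xa; constructor=> y.
by rewrite /forest_le xa => yx; exact: IHa yx _ _.
Qed.

Lemma forest_le_trans : transitive forest_le.
Proof. by move=> y x z; exact: elt_le_trans. Qed.

Lemma forest_le_complete : complete_lattice forest_le.
Proof.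
apply: (@wf_meet_complete _ 1) forest_le_wf.
- by move=> x; exact: elt_le_refl.
- exact: forest_le_trans.
- by move=> x; rewrite /forest_le; case: (elt_of x).
move=> x y; have [c [cx cy maxc]] := elt_meet (elt_of x) (elt_of y).
exists (nat_of c); split=> [_ [] ->|u lbu]; rewrite /forest_le nat_ofK //.
by apply: maxc; apply: lbu; [left | right].
Qed.

Lemma forest_le_lattice : lattice_ordering forest_le.
Proof.
split=> [x|x y /andP[xy yx]||x y]; first exact: elt_le_refl.
- by apply: (can_inj elt_ofK); exact: elt_le_anti.
- exact: forest_le_trans.
- exact: forest_le_complete.
Qed.

(** The nodes along a path have supremum [Cap i], but finitely many of them lie
   below a single one. An arbitrary [x] below the cap is allowed because the lemma
   serves twice: for the cap itself and for a node off the path. *)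
Lemma path_not_compact i f x :
  (forall k, T i (segment f k)) -> forest_le x (nat_of (Cap i)) ->
  (forall k, ~~ forest_le x (nat_of (Node i (segment f k)))) ->
  ~ compact_elements forest_le x.
Proof.
move=> Tf xi xN.
pose S := [set y | exists k, y = nat_of (Node i (segment f k))].
have supS : is_sup forest_le S (nat_of (Cap i)).
  split=> [_ [k ->]|u ubu]; first by rewrite forest_le_nat_of /= eqxx Tf.
  have {}ubu k : elt_le (Node i (segment f k)) (elt_of u).
    by rewrite -[Node _ _]nat_ofK; apply: ubu; exists k.
  rewrite /forest_le nat_ofK; case: (elt_of u) ubu => [||j|j t] ubu //.
  - by have := ubu 0.
  - by have /andP[] := ubu 0.
  (* A node above all the segments would have a code at least as large as
     theirs, but these codes are unbounded. *)
  - have : segment f t.+1 <= t.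
      by have /andP[_ /predU1P[->|/andP[/anc_leq]]] := ubu t.+1.
    by rewrite leqNgt leq_segment.
move=> /(_ S _ supS xi)[S' [S'S /finite_seqP[r S'r] [s' [_ lubs'] xs']]].
have [K ubK] : exists K, forall y, y \in r -> S y -> forest_le y (nat_of (Node i (segment f K))).
  elim: r {S'r} => [|y r [K ubK]]; first by exists 0.
  have [[j ->]|NSy] := pselect (S y).
    exists (maxn j K) => z; rewrite inE => /predU1P[->|/ubK le_y] Sy.
      by rewrite forest_le_nat_of /= eqxx anc_segment ?leq_maxl ?Tf ?orbT.
    apply: forest_le_trans (le_y Sy) _.
    by rewrite forest_le_nat_of /= eqxx anc_segment ?leq_maxr ?Tf ?orbT.
  by exists K => z; rewrite inE => /predU1P[->//|]; exact: ubK.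
have /negP[] := xN K; apply: forest_le_trans xs' _; apply: lubs' => y S'y.
by apply: ubK (S'S _ S'y); move: S'y; rewrite S'r.
Qed.

(** Suppose [Cap i] is below the supremum of [S] but below that of no finite
   subset. Then any two members of [S] have an upper bound that is not above
   [Cap i], which confines [S] to [Bot] and a chain of nodes of [T i]. The
   chain has no largest element, since such an element would be the supremum,
   so the prefixes of its members contain an infinite path of [T i]. *)
Lemma cap_compact i :
  (forall f, exists k, ~~ T i (segment f k)) ->
  compact_elements forest_le (nat_of (Cap i)).
Proof.
move=> no_path S s [ubs lubs] Cs; apply: contrapT => noS'.
have {}lubs b : (forall y, S y -> elt_le (elt_of y) b) -> elt_le (Cap i) b.
  move=> ub; rewrite -[Cap i]nat_ofK -[b]nat_ofK; apply: forest_le_trans Cs _.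
  by apply: lubs => y /ub; rewrite /forest_le nat_ofK.
have pair_ub x y : S x -> S y -> exists u,
    [/\ elt_le (elt_of x) u, elt_le (elt_of y) u & ~~ elt_le (Cap i) u].
  move=> Sx Sy; have [[u [ubu lubu]] _] := forest_le_complete [set x; y].
  exists (elt_of u); split; [by apply: ubu; left | by apply: ubu; right |].
  apply/negP => Cu; apply: noS'; exists [set x; y]; split.
  - by move=> _ [] ->.
  - exact: finite_set2.
  - by exists u; [split | rewrite /forest_le nat_ofK].
(* One member [x] other than [Bot] determines the summand that contains [S]. *)
have [x Sx xN0] : exists2 x, S x & elt_of x <> Bot.
  apply: contrapT => noS; suff : elt_le (Cap i) Bot by [].
  apply: lubs => y Sy; have [->//|yN0] := pselect (elt_of y = Bot).
  by case: noS; exists y.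
have no_bound b : (forall u, elt_le (elt_of x) u -> ~~ elt_le (Cap i) u -> elt_le u b) ->
    elt_le (Cap i) b.
  move=> ub; apply: lubs => y Sy; have [u [xu yu uN]] := pair_ub _ _ Sx Sy.
  exact/(elt_le_trans yu)/ub.
have [t Ex Tt] : exists2 t, elt_of x = Node i t & T i t.
  have [u [xu _ uN]] := pair_ub _ _ Sx Sx.
  case: (elt_of x) xN0 xu no_bound => [||j|j t] // _ xu no_bound.
  - by case: u xu uN.
  - have /eqP eij : elt_le (Cap i) (Cap j).
      by apply: no_bound => -[||k|k w] //= /eqP->.
    by case: u xu uN => [||k|k w] //= /eqP <-; rewrite eij eqxx.
  - have [Tt|TtN] := boolP (T j t); last first.
      suff : elt_le (Cap i) (Node j t) by [].
      apply: no_bound => -[||k|k w] //=; first by rewrite (negPf TtN) andbF.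
      move=> /andP[/eqP<- /predU1P[->|/andP[/T_anc ts /ts]]]; rewrite ?eqxx //.
      by rewrite (negPf TtN).
    have /eqP eij : elt_le (Cap i) (Cap j).
      apply: no_bound => -[||k|k w] //=; first by move=> /andP[/eqP->].
      by move=> /andP[/eqP<- /predU1P[<-|/andP[_ ->]]]; rewrite eqxx ?Tt.
    by rewrite eij; exists t => //; rewrite -eij in Tt.
have nodes y : S y -> elt_of y = Bot \/ exists2 t', elt_of y = Node i t' & T i t'.
  move=> Sy; have [u []] := pair_ub _ _ Sx Sy.
  rewrite Ex; case: u => [||k|k w] //=; first by move=> /andP[/eqP-> _] _; rewrite eqxx.
  move=> /andP[/eqP<- tw] yw _.
  have Tw : T i w by case/predU1P: tw => [<-|/andP[]].
  case: (elt_of y) yw => [||k'|k' v] //=; first by left.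
  by move=> /andP[/eqP-> /predU1P[->|/andP[/T_anc vw _]]]; right; [exists w | exists v; rewrite ?vw].
(* The prefixes of the members of [S]; the path is built inside [D]. *)
pose D w := exists2 y, S y & exists2 t', elt_of y = Node i t' & anc w t'.
have D_child w : D w -> exists v, D (child w v).
  move=> [y Sy [t' Ey wt']].
  have [[z Sz [t2 [Ez [t'2 t'N2]]]]|maxy] := pselect (exists2 z, S z & exists t2,
      elt_of z = Node i t2 /\ anc t' t2 /\ t' != t2).
    have [|v wv] := anc_strict (anc_trans wt' t'2).
      by apply: contraNneq t'N2 => e; rewrite eqn_leq (anc_leq t'2) -e (anc_leq wt').
    by exists v, z => //; exists t2.
  suff : elt_le (Cap i) (Node i t') by [].
  apply: lubs => z Sz; have [->//|[t2 Ez Tt2]] := nodes _ Sz.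
  have [u []] := pair_ub _ _ Sy Sz; rewrite Ey Ez.
  case: u => [||k|k u] //=; first by move=> /andP[/eqP-> _] _; rewrite eqxx.
  move=> /andP[/eqP<- /node_le_anc t'u] /andP[_ /node_le_anc t2u] _; rewrite eqxx /=.
  have Tt' : T i t' by have [|[v]] := nodes _ Sy; rewrite Ey // => -[->].
  have [<-|t2N] := eqVneq t2 t'; first by [].
  rewrite Tt' andbT.
  have /orP[//|t't2] := anc_total t2u t'u.
  by case: maxy; exists z => //; exists t2; rewrite eq_sym.
have [|h Dh] := @choice nat nat (fun w v => D w -> D (child w v)).
  move=> w; have [/D_child[v Dv]|NDw] := pselect (D w); first by exists v.
  by exists 0.
pose p := fix p k := if k is k'.+1 then child (p k') (h (p k')) else 0.
have segmentE k : segment (fun k => h (p k)) k = p k by elim: k => //= k ->.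
have Dp k : D (p k).
  elim: k => [|k IHk]; last exact: Dh.
  by exists x => //; exists t => //; exact: anc0s.
have [k /negP[]] := no_path (fun k => h (p k)).
rewrite segmentE; have [y Sy [t' Ey]] := Dp k; move/T_anc; apply.
by have [|[t2]] := nodes _ Sy; rewrite Ey // => -[<-].
Qed.

(** In a full tree the sequence consisting of a single 0 is not compact, because
   the path of constant value 1 avoids it. So the compact elements below it are
   among [Bot] and the root, and their supremum is too small. *)
Lemma full_not_generated i :
  (forall s, T i s) -> ~ compactly_generated forest_le.
Proof.
move=> Ti /(_ (nat_of (Node i (child 0 0))))[S compS [ubS lubS]].
have /lubS : forall y, S y -> forest_le y (nat_of (Node i 0)).
  move=> y Sy; have := ubS y Sy; have := compS y Sy.
  rewrite -[y]elt_ofK !forest_le_nat_of; case: (elt_of y) => [||j|j t] // comp_y.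
  move=> /andP[/eqP ej]; rewrite {j}ej /= in comp_y *; rewrite !Ti !andbT eqxx /=.
  have [et|tN] := eqVneq t (child 0 0); last by rewrite anc_child (negPf tN) /= => ->; rewrite orbT.
  case: (@path_not_compact i (fun=> 1) _ _ _ _ comp_y) => [k||k]; first exact: Ti.
    by rewrite (forest_le_nat_of (Node i t)) /= eqxx Ti.
  rewrite (forest_le_nat_of (Node i t)) /= eqxx Ti andbT /= negb_or et.
  have cN : ~~ anc (child 0 0) (segment (fun=> 1) k).
    apply/negP => /(@anc_lookup _ _ 0).
    by rewrite lookup_child depth0 lookup_segment /= => /(_ isT); case: ifP.
  by rewrite cN andbT; apply: contraNneq cN => <-; exact: anc_refl.
rewrite forest_le_nat_of /= eqxx Ti andbT => /anc_leq.
by rewrite leqn0.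
Qed.

Lemma computable_forest_le :
  computable2 (fun i s => T i s : nat) -> computable_rel forest_le.
Proof.
move=> cT.
pose code_le x y := [|| x == 0, y == 1, x == y |
  [&& 2 <= x, 2 <= y, nfst x.-2 == nfst y.-2 &
    (nsnd y.-2 == 0) && ((nsnd x.-2 == 0) || T (nfst x.-2) (nsnd x.-2).-1) ||
    [&& nsnd y.-2 != 0, nsnd x.-2 != 0, anc (nsnd x.-2).-1 (nsnd y.-2).-1 &
        T (nfst y.-2) (nsnd y.-2).-1]]].
have eq_SS i s j t : ((npair i s).+2 == (npair j t).+2) = (i == j) && (s == t).
  exact: npair_eq.
(* Equality is tested on the codes, so that [code_le] need only be correct for
   distinct elements of the same summand. *)
have leE x y : forest_le x y = code_le x y.
  rewrite -[x]elt_ofK -[y]elt_ofK forest_le_nat_of /code_le.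
  case: (elt_of x) (elt_of y) => [||i|i s] [||j|j t];
    rewrite /nat_of ?succnK ?npairE ?eq_SS ?succnK ?eqxx ?andbT ?andbF ?orbF ?orbb //=.
  by case: eqP => [->|].
rewrite /computable_rel; apply: (@computable_ext (fun n => code_le (nfst n) (nsnd n) : nat)).
  by move=> n; rewrite leE.
rewrite /code_le; computable.
- by apply: (computable_comp2 cT); computable.
- by apply: (computable_comp2 computable_anc); computable.
- by apply: (computable_comp2 cT); computable.
Qed.

End Forest.

(** * The lattice of all computation trees *)

Lemma cap_compactP e n :
  compact_elements (forest_le survives) (nat_of (Cap (npair (instr e) n))) <->
  forall f, halts f e n.
Proof.
split=> [comp f|halts_all]; last first.
  apply: cap_compact => [i s t|f]; first exact: survives_anc.
  apply: contrapT => /forallNP leaves; have [no_halt _] := survives_path f e n.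
  by apply: no_halt (halts_all f) => k; apply: contrapT => /negP /leaves.
apply: contrapT => /survives_path surv.
apply: (path_not_compact survives_anc surv _ _ comp).
  by rewrite forest_le_nat_of elt_le_refl.
by move=> k; rewrite forest_le_nat_of.
Qed.

Theorem proposition2p9 :
  exists le : rel nat,
    [/\ computable_lattice le,
        complete_lattice le,
        Pi11_hard (compact_elements le)
      & ~ algebraic_lattice le].
Proof.
exists (forest_le survives); split.
- split; first exact/forest_le_lattice/survives_anc.
  exact/computable_forest_le/computable_survives.
- exact/forest_le_complete/survives_anc.
- move=> _ [e ->]; exists (fun n => nat_of (Cap (npair (instr e) n))).
    by rewrite /nat_of; computable.
  by move=> n; apply: iff_sym; exact: cap_compactP.
(* An unbounded search for a zero of a function with constant value 1. *)
- case=> _; pose e := cmu (ccomp csucc czero).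
  apply: (@full_not_generated _ survives_anc (npair (instr e) 0)) => s.
  by apply: survives_never => f [m [[x -> ]]].
Qed.
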